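(* Let $K=\{1,2,\dots,25\}$ be the idempotent groupoid whose Cayley table (rows and columns in the natural order $1,2,\dots,25$) is determined by the $7$-translatable sequence $$1,5,9,13,17,21,25,4,8,12,16,20,24,3,7,11,15,19,23,2,6,10,14,18,22.$$ Then $K$ is a quadratical quasigroup, and $K$ is not isomorphic to any of $Q1\times Q1$, $Q1\times (Q1)^*$, $(Q1)^*\times Q1$, $(Q1)^*\times (Q1)^*$.
   Context: A groupoid is a nonempty set with a binary operation. A groupoid $G$ is right solvable if for all $a,b\in G$ there is a unique $x\in G$ with $ax=b$. It has property A if $(xy)x=(zx)(yz)$ for all $x,y,z\in G$. A quadratical quasigroup is a right solvable groupoid with property A (such a groupoid is known to be a quasigroup). A groupoid is idempotent if $xx=x$ for all $x$. For a groupoid on $\{1,\dots,n\}$ and $k\in\{1,\dots,n\}$, the Cayley table is determined by the $k$-translatable sequence $x_1,\dots,x_n$ if its first row is $1\cdot j=x_j$ ($1\le j\le n$) and, for each $q\in\{2,\dots,n\}$, row $q$ is obtained from row $q-1$ by moving its last $k$ entries, in order, to the front; i.e. $q\cdot j=(q-1)\cdot j'$ where $j'\in\{1,\dots,n\}$ and $j'\equiv j-k \pmod n$. The dual of a groupoid $(G,\cdot)$ is $G^*=(G,* )$ with $x*y=y\cdot x$. $Q1$ is the groupoid on five elements $a,\ ab,\ ba,\ b,\ aba$ with the following Cayley table (each row lists the products of the row element on the left with $a,ab,ba,b,aba$ on the right, in this order): row $a$: $a,\ ba,\ aba,\ ab,\ b$; row $ab$: $aba,\ ab,\ b,\ a,\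 ba$; row $ba$: $b,\ a,\ ba,\ aba,\ ab$; row $b$: $ba,\ aba,\ ab,\ b,\ a$; row $aba$: $ab,\ b,\ a,\ ba,\ aba$. Products of groupoids are direct products with componentwise operation. *)

(* Defs.v *)
From mathcomp Require Import all_boot.
Set Implicit Arguments.
Unset Strict Implicit.
Unset Printing Implicit Defensive.

(* "Groupoid" in the universal-algebra sense: a nonempty magma. *)
Record groupoid := Groupoid {
  carrier :> Type;
  gmul : carrier -> carrier -> carrier;
  groupoid_nonempty : inhabited carrier
}.

Definition idempotent_groupoid (G : groupoid) : Prop :=
  idempotent_op (@gmul G).

Definition right_solvable (G : groupoid) : Prop :=
  forall a b : G, exists! x : G, gmul a x = b.

Definition property_A (G : groupoid) : Prop :=
  forall x y z : G,
    gmul (gmul x y) x = gmul (gmul z x) (gmul y z).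

(* Left solvability is not part of the definition: it is a consequence. *)
Definition quadratical_quasigroup (G : groupoid) : Prop :=
  right_solvable G /\ property_A G.

Definition dual (G : groupoid) : groupoid :=
  Groupoid (fun x y : G => gmul y x) (groupoid_nonempty G).

Definition prod_nonempty (A B : Type) (a : inhabited A) (b : inhabited B) :
    inhabited (A * B) :=
  let: inhabits x := a in let: inhabits y := b in inhabits (x, y).

Definition gprod (G H : groupoid) : groupoid :=
  @Groupoid (G * H)%type
    (fun u v => (gmul u.1 v.1, gmul u.2 v.2))
    (prod_nonempty (groupoid_nonempty G) (groupoid_nonempty H)).

Definition isomorphic (G H : groupoid) : Prop :=
  exists f : G -> H,
    bijective f /\ (forall x y : G, f (gmul x y) = gmul (f x) (f y)).

(* The set {1, ..., n} is represented by 'I_n, where i : 'I_n stands for the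
   element i + 1. *)
Definition label (n : nat) (i : 'I_n) : nat := i.+1.

Definition ord_groupoid (n : nat) (op : 'I_n.+1 -> 'I_n.+1 -> 'I_n.+1) :
    groupoid :=
  Groupoid op (inhabits ord0).

(* The entry x_j of the sequence x_1, ..., x_n is [nth 0 x j.-1]. *)
Definition determined_by_translatable_seq (n k : nat) (x : seq nat)
    (op : 'I_n -> 'I_n -> 'I_n) : Prop :=
  [/\ 0 < k <= n,
      size x = n,
      forall i j : 'I_n,
        label i = 1 -> label (op i j) = nth 0 x (label j).-1
    & forall q q' j j' : 'I_n,
        label q = (label q').+1 ->
        label j' + k = label j %[mod n] ->
        op q j = op q' j'].

Inductive Q1_elt := q_a | q_ab | q_ba | q_b | q_aba.

Definition Q1_mul (x y : Q1_elt) : Q1_elt :=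
  match x, y with
  | q_a, q_a => q_a | q_a, q_ab => q_ba | q_a, q_ba => q_aba
  | q_a, q_b => q_ab | q_a, q_aba => q_b
  | q_ab, q_a => q_aba | q_ab, q_ab => q_ab | q_ab, q_ba => q_b
  | q_ab, q_b => q_a | q_ab, q_aba => q_ba
  | q_ba, q_a => q_b | q_ba, q_ab => q_a | q_ba, q_ba => q_ba
  | q_ba, q_b => q_aba | q_ba, q_aba => q_ab
  | q_b, q_a => q_ba | q_b, q_ab => q_aba | q_b, q_ba => q_ab
  | q_b, q_b => q_b | q_b, q_aba => q_a
  | q_aba, q_a => q_ab | q_aba, q_ab => q_b | q_aba, q_ba => q_a
  | q_aba, q_b => q_ba | q_aba, q_aba => q_aba
  end.

Definition Q1 : groupoid := Groupoid Q1_mul (inhabits q_a).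

Definition K_seq : seq nat :=
  [:: 1; 5; 9; 13; 17; 21; 25; 4; 8; 12; 16; 20; 24; 3; 7; 11; 15; 19; 23; 2;
      6; 10; 14; 18; 22].

(* Main.v *)
Require Import Defs.
From mathcomp Require Import all_boot.
From mathcomp Require Import all_algebra ring.

(** Shifting the labels to the residues 0, ..., 24, the first row of the table
    is [0 * j = 4 j] and each further row replaces [j] by [j - 7], so that
    [q * j = 4 (j - 7 q) = (1 - 4) q + 4 j] modulo 25, because [-28 = 1 - 4].
    Thus K is the affine idempotent groupoid of slope [c = 4] over Z/25
    ([translatable_affine]).

    An affine groupoid [x * y = (1 - c) x + c y] over a commutative ring is a
    quadratical quasigroup as soon as [2 c ^ 2 - 2 c + 1 = 0]
    ([affine_quadratical]); for [c = 4] the left-hand side is 25.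

    To separate K from the four products, consider the identity
    [x (x (x (x y))) = y].  Q1 is an affine groupoid over the field with five
    elements, and there its left and right translations are multiplications by
    nonzero elements around a fixed point, hence have order dividing 4.  So the
    identity holds in Q1 and in its dual, hence in their products
    ([left_period4_prod]), and in any groupoid isomorphic to one of these
    ([left_period4_iso]).  In K the translation by the residue 0 is
    multiplication by 4, and [4 ^ 4 = 6] modulo 25, so the identity fails. *)

Import GRing.Theory.

(** The two sides of property A differ by [(x - z) (2 c ^ 2 - 2 c + 1)].  The
    same hypothesis reads [(2 - 2 c) c = 1], so [c] is invertible, which gives
    right solvability. *)
Lemma affine_quadratical (R : comNzRingType) (c : R) (op : R -> R -> R)
    (inh : inhabited R) :
  (forall x y, op x y = (1 - c) * x + c * y)%R ->
  (2%:R * c ^+ 2 - 2%:R * c + 1 = 0)%R ->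
  quadratical_quasigroup (Groupoid op inh).
Proof.
move=> opE c_root; split=> [a b | x y z] /=.
- have c_inv : ((2%:R - 2%:R * c) * c = 1)%R.
    by rewrite -[LHS]addr0 -c_root; ring.
  exists ((2%:R - 2%:R * c) * (b - (1 - c) * a))%R; split=> [|x <-].
    by rewrite /= opE mulrA (mulrC c) c_inv; ring.
  by rewrite /= opE [(_ + c * x)%R]addrC addrK mulrA c_inv mul1r.
- rewrite !opE; apply/eqP; rewrite -subr_eq0; apply/eqP.
  rewrite -[RHS](mulr0 (x - z)%R) -c_root; ring.
Qed.

(** The identity [x (x (x (x y))) = y]: the order of every left translation
    divides 4. *)
Definition left_period4 (G : groupoid) : Prop :=
  forall x y : G, iter 4 (gmul x) y = y.

Lemma left_period4_Q1 : left_period4 Q1.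
Proof. by case; case. Qed.

Lemma left_period4_dual_Q1 : left_period4 (dual Q1).
Proof. by case; case. Qed.

Lemma left_period4_prod (G H : groupoid) :
  left_period4 G -> left_period4 H -> left_period4 (gprod G H).
Proof.
move=> perG perH [x1 x2] [y1 y2].
by congr pair; [exact: perG x1 y1 | exact: perH x2 y2].
Qed.

Lemma left_period4_iso (G H : groupoid) :
  isomorphic G H -> left_period4 H -> left_period4 G.
Proof.
move=> [f [f_bij fM]] perH x y; apply: (bij_inj f_bij).
by rewrite /= !fM; apply: perH.
Qed.

Lemma K_seqE (j : 'Z_25) : nth 0 K_seq j = (4%:R * j : 'Z_25)%R.+1.
Proof. by case: j; do 25?case=> //. Qed.

Lemma label_shift (j j' : 'Z_25) :
  label j' + 7 = label j %[mod 25] <-> j = (j' + 7%:R)%R.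
Proof.
rewrite /label addSn -(addn1 (j' + 7)) -(addn1 j).
have -> : (j' + 7 + 1 = j + 1 %[mod 25]) <-> (j' + 7 = j %[mod 25]).
  by split=> /eqP; [rewrite eqn_modDr | rewrite -(eqn_modDr 1)] => /eqP.
by rewrite (modn_small (ltn_ord j)); split=> [eq_j | ->] //; apply: val_inj.
Qed.

Lemma label_succ (q q' : 'Z_25) : label q = (label q').+1 -> q = (q' + 1)%R.
Proof.
rewrite /label => -[def_q]; apply: val_inj.
by rewrite /= addn1 -def_q modn_small.
Qed.

Lemma char25 : (25%:R = 0 :> 'Z_25)%R.
Proof. exact: val_inj. Qed.

(** Going up one row costs a shift of the column by 7, so row [q] is row 0 read
    at column [j - 7 q]. *)
Lemma translatable_affine (op : 'Z_25 -> 'Z_25 -> 'Z_25) :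
  determined_by_translatable_seq 7 K_seq op ->
  forall q j, (op q j = (1 - 4%:R) * q + 4%:R * j)%R.
Proof.
move=> [_ _ row0 rowS] q.
have [n le_n] : exists n, n = q :> nat by exists q.
elim: n q le_n => [|n IHn] q def_q j.
  have -> : q = 0%R by apply: val_inj.
  rewrite mulr0 add0r; apply: val_inj; apply: succn_inj.
  by rewrite -K_seqE; apply: row0.
have lt_n : n < 25 by apply: ltnW; rewrite def_q; apply: ltn_ord.
pose q' : 'Z_25 := Ordinal lt_n.
have q_succ : label q = (label q').+1 by rewrite /label -def_q.
have j_shift : j = (j - 7%:R + 7%:R)%R by rewrite subrK.
rewrite (rowS _ _ _ _ q_succ (proj2 (label_shift _ _) j_shift)) IHn //.
rewrite (label_succ _ _ q_succ); apply/eqP; rewrite -subr_eq0; apply/eqP.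
(* The row contributes [3] and the column [- 28], in total [(- 1) * 25]. *)
rewrite -[RHS](mulr0 (-1)%R) -char25; ring.
Qed.

Theorem theorem8p6 :
  (exists op : 'I_25 -> 'I_25 -> 'I_25,
      idempotent_groupoid (ord_groupoid op) /\
      determined_by_translatable_seq 7 K_seq op) /\
  (forall op : 'I_25 -> 'I_25 -> 'I_25,
      idempotent_groupoid (ord_groupoid op) ->
      determined_by_translatable_seq 7 K_seq op ->
      let K := ord_groupoid op in
      quadratical_quasigroup K /\
      ~ isomorphic K (gprod Q1 Q1) /\
      ~ isomorphic K (gprod Q1 (dual Q1)) /\
      ~ isomorphic K (gprod (dual Q1) Q1) /\
      ~ isomorphic K (gprod (dual Q1) (dual Q1))).
Proof.
split.
  exists (fun q j : 'Z_25 => (1 - 4%:R) * q + 4%:R * j)%R; split.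
    by move=> x /=; ring.
  split=> // [i j [i0] | q q' j j' /label_succ -> /label_shift ->].
    have -> : i = 0%R :> 'Z_25 by apply: val_inj.
    by rewrite mulr0 add0r K_seqE.
  apply/eqP; rewrite -subr_eq0; apply/eqP.
  (* The row contributes [- 3] and the column [28], in total [1 * 25]. *)
  rewrite -[RHS](mulr0 1%R) -char25; ring.
move=> op _ op_seq K; have opE := translatable_affine op op_seq.
have not_per : ~ left_period4 K.
  move/(_ (0%R : 'Z_25) (1%R : 'Z_25)); rewrite /= !opE.
  by move/(congr1 val).
have not_iso H : left_period4 H -> ~ isomorphic K H.
  by move=> perH isoKH; apply/not_per/(left_period4_iso _ _ isoKH).
split; first by apply: (affine_quadratical _ _ _ _ opE); apply: val_inj.
by do ![split]; apply/not_iso/left_period4_prod;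
  first [exact: left_period4_Q1 | exact: left_period4_dual_Q1].
Qed.
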